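(* Let $n\geq 3$ be a natural number. The commutator subgroup $[P_n,P_n]$ of the pure braid group $P_n$ coincides with the normal subgroup of $B_n$ generated by the elements $[\sigma_i^2,\sigma_{i+1}^2]$, with $1\leq i\leq n-2$.
   Context: For $n\geq 3$, $B_n$ denotes the braid group on $n$ strands: generators $\sigma_i$, $1\leq i\leq n-1$, and relations $\sigma_i\sigma_j=\sigma_j\sigma_i$ if $|i-j|\geq 2$, and $\sigma_i\sigma_{i+1}\sigma_i=\sigma_{i+1}\sigma_i\sigma_{i+1}$ for $1\leq i\leq n-2$. The pure braid group $P_n$ is the kernel of the canonical surjective homomorphism $\pi:B_n\to S_n$, $\pi(\sigma_i)=s_i$, where $s_i=(i,i+1)$. For elements $x,y$ of a group, $[x,y]:=x^{-1}y^{-1}xy$; for a group $G$, $[G,G]=G'$ denotes the subgroup generated by all commutators $[x,y]$ with $x,y\in G$. The normal subgroup of $B_n$ generated by a set is the smallest normal subgroup of $B_n$ containing it. *)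

(* Defs.v *)
From HB Require Import structures.
From mathcomp Require Import all_boot all_fingroup.
From mathcomp Require Import generic_quotient boolp classical_sets.

Set Implicit Arguments.
Unset Strict Implicit.
Unset Printing Implicit Defensive.

Import Algebra.
Local Open Scope quotient_scope.
Local Open Scope classical_set_scope.
Local Open Scope group_scope.

(* The letter (t, true) stands for the generator t, and (t, false) for its
   inverse. *)
Notation word T := (seq (T * bool)).

Definition inv_word (T : Type) (w : word T) : word T :=
  rev [seq (l.1, ~~ l.2) | l <- w].

Section Presentation.
Variables (T : choiceType) (R : word T -> word T -> Prop).

Inductive pres_cong : word T -> word T -> Prop :=
| PresRel u v : R u v -> pres_cong u v
| PresCancel t b : pres_cong [:: (t, b); (t, ~~ b)] [::]
| PresCat u u' v v' :
    pres_cong u u' -> pres_cong v v' -> pres_cong (u ++ v) (u' ++ v')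
| PresRefl u : pres_cong u u
| PresSym u v : pres_cong u v -> pres_cong v u
| PresTrans v u w : pres_cong u v -> pres_cong v w -> pres_cong u w.

Lemma pres_cong_invr (w : word T) : pres_cong (w ++ inv_word w) [::].
Proof.
elim: w => [|[t b] w IHw]; first exact: PresRefl.
rewrite /inv_word /= rev_cons -cats1 -cat_cons catA.
apply: (PresTrans (v := ([:: (t, b)] ++ [::]) ++ [:: (t, ~~ b)])).
  apply: PresCat (PresRefl _); rewrite -[(t, b) :: w]cat1s -catA.
  exact: PresCat (PresRefl _) IHw.
exact: PresCancel.
Qed.

Lemma inv_wordK : involutive (@inv_word T).
Proof.
move=> w; rewrite /inv_word map_rev revK -map_comp map_id_in // => -[t b] _ /=.
by rewrite negbK.
Qed.

Lemma pres_cong_invl (w : word T) : pres_cong (inv_word w ++ w) [::].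
Proof. by rewrite -{2}[w]inv_wordK; apply: pres_cong_invr. Qed.

Lemma pres_cong_inv (u v : word T) :
  pres_cong u v -> pres_cong (inv_word u) (inv_word v).
Proof.
move=> uv; apply: (PresTrans (v := inv_word u ++ v ++ inv_word v)).
  rewrite -{1}[inv_word u]cats0; apply: PresCat (PresRefl _) _.
  exact/PresSym/pres_cong_invr.
rewrite catA -[X in pres_cong _ X]cat0s; apply: PresCat (PresRefl _).
apply: PresTrans (pres_cong_invl u).
by apply: PresCat (PresRefl _) _; apply: PresSym.
Qed.

Definition pres_congb (u v : word T) : bool := `[< pres_cong u v >].

Lemma pres_congb_refl : reflexive pres_congb.
Proof. by move=> u; apply/asboolP/PresRefl. Qed.
Lemma pres_congb_sym : symmetric pres_congb.
Proof. by move=> u v; apply/asboolP/asboolP; apply: PresSym. Qed.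
Lemma pres_congb_trans : transitive pres_congb.
Proof. by move=> v u w /asboolP uv /asboolP vw; apply/asboolP/(PresTrans uv vw). Qed.

Canonical pres_equiv :=
  EquivRel pres_congb pres_congb_refl pres_congb_sym pres_congb_trans.

(* The group with generators T and relations u = v for R u v. *)
Definition presented_group := {eq_quot pres_equiv}.
HB.instance Definition _ := Choice.on presented_group.
HB.instance Definition _ := EqQuotient.on presented_group.

Lemma eq_presP (u v : word T) :
  \pi_presented_group u = \pi_presented_group v <-> pres_cong u v.
Proof.
split=> [/eqP|uv]; first by rewrite eqmodE => /asboolP.
by apply/eqP; rewrite eqmodE; apply/asboolP.
Qed.

Lemma pres_cong_repr (u : word T) :
  pres_cong (repr (\pi_presented_group u)) u.
Proof. by apply/eq_presP; rewrite reprK. Qed.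

Definition pres_one : presented_group := \pi_presented_group [::].
Definition pres_mul (x y : presented_group) : presented_group :=
  \pi_presented_group (repr x ++ repr y).
Definition pres_inv (x : presented_group) : presented_group :=
  \pi_presented_group (inv_word (repr x)).

Lemma pres_mulE u v :
  pres_mul (\pi_presented_group u) (\pi_presented_group v) =
  \pi_presented_group (u ++ v).
Proof. by apply/eq_presP/PresCat; apply: pres_cong_repr. Qed.

Lemma pres_invE u :
  pres_inv (\pi_presented_group u) = \pi_presented_group (inv_word u).
Proof. by apply/eq_presP/pres_cong_inv/pres_cong_repr. Qed.

Lemma pres_mulA : associative pres_mul.
Proof.
elim/quotW=> u; elim/quotW=> v; elim/quotW=> w.
by rewrite (pres_mulE v w) (pres_mulE u v) !pres_mulE catA.
Qed.
Lemma pres_mul1 : left_id pres_one pres_mul.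
Proof. by elim/quotW=> u; rewrite (pres_mulE [::] u). Qed.
Lemma pres_mulr1 : right_id pres_one pres_mul.
Proof. by elim/quotW=> u; rewrite (pres_mulE u [::]) cats0. Qed.
Lemma pres_mulV : left_inverse pres_one pres_inv pres_mul.
Proof.
elim/quotW=> u; rewrite pres_invE pres_mulE.
exact/eq_presP/pres_cong_invl.
Qed.
Lemma pres_mulrV : right_inverse pres_one pres_inv pres_mul.
Proof.
elim/quotW=> u; rewrite pres_invE pres_mulE.
exact/eq_presP/pres_cong_invr.
Qed.

HB.instance Definition _ := isGroup.Build presented_group
  pres_mulA pres_mul1 pres_mulr1 pres_mulV pres_mulrV.

Definition pres_gen (t : T) : presented_group := \pi_presented_group [:: (t, true)].

Section Lift.
Variables (H : groupType) (f : T -> H).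

Definition word_eval (w : word T) : H :=
  \prod_(l <- w) (if l.2 then f l.1 else (f l.1)^-1).

Definition pres_lift (x : presented_group) : H := word_eval (repr x).

Lemma word_eval_cat u v : word_eval (u ++ v) = word_eval u * word_eval v.
Proof. exact: big_cat. Qed.

Hypothesis Rf : forall u v, R u v -> word_eval u = word_eval v.

Lemma word_eval_cong u v : pres_cong u v -> word_eval u = word_eval v.
Proof.
elim=> [u' v'|t b|u1 u2 v1 v2 _ e1 _ e2|//|u' v' _ ->//|v' u' w _ -> _ ->//].
- exact: Rf.
- rewrite /word_eval !big_cons big_nil /= mulg1.
  by case: b; rewrite /= ?mulgV ?mulVg.
- by rewrite !word_eval_cat e1 e2.
Qed.

Lemma pres_liftE u : pres_lift (\pi_presented_group u) = word_eval u.
Proof. exact/word_eval_cong/pres_cong_repr. Qed.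

Lemma pres_lift_gen t : pres_lift (pres_gen t) = f t.
Proof. by rewrite pres_liftE /word_eval big_seq1. Qed.

Lemma pres_liftM : {morph pres_lift : x y / x * y}.
Proof.
elim/quotW=> u; elim/quotW=> v.
by rewrite [_ * _](pres_mulE u v) !pres_liftE word_eval_cat.
Qed.
End Lift.

End Presentation.

Section Subgroups.
Variable G : groupType.
Implicit Types (H A : set G).

Definition subgroup H : Prop := group_closed [in H].

Lemma subgroupP H : subgroup H <->
  [/\ H 1, forall x y, H x -> H y -> H (x * y) & forall x, H x -> H x^-1].
Proof.
split=> [[h1 hd]|[h1 hM hV]]; last first.
  by split=> [|x y]; rewrite !inE // => hx hy; apply/hM/hV.
have {}h1 : H 1 by move: h1; rewrite inE.
have hV x : H x -> H x^-1.
  by move=> hx; have := hd 1 x; rewrite div1g !inE; apply.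
split=> // x y hx hy; have := hd x y^-1; rewrite invgK !inE.
by apply=> //; apply: hV.
Qed.

Definition normal_subgroup H : Prop :=
  subgroup H /\ forall x y, H x -> H (x ^ y).

Definition generated_subgroup A : set G := smallest subgroup A.

Definition commutator_subgroup H : set G :=
  generated_subgroup [set [~ x, y] | x in H & y in H].

Definition normal_closure A : set G := smallest normal_subgroup A.
End Subgroups.

Section Braid.
Variable n : nat.
Local Notation I := 'I_n.-1.
Local Notation s i := ((i : I), true).

(* Indices start from 0: i : 'I_n.-1 encodes sigma_(i+1). *)
Inductive braid_rel : word I -> word I -> Prop :=
| BraidFar (i j : I) : (i + 2 <= j) || (j + 2 <= i) ->
    braid_rel [:: s i; s j] [:: s j; s i]
| BraidAdj (i j : I) : j = i.+1 :> nat ->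
    braid_rel [:: s i; s j; s i] [:: s j; s i; s j].

Definition braid_group : groupType := presented_group braid_rel.

Definition sigma (i : I) : braid_group := pres_gen braid_rel i.

Lemma strand_succ_subproof (i : I) : i.+1 < n.
Proof. by rewrite -ltn_predRL. Qed.

Definition strand (i : I) : 'I_n := widen_ord (leq_pred n) i.
Definition strand_succ (i : I) : 'I_n := Ordinal (strand_succ_subproof i).

Definition adj_transp (i : I) : 'S_n := tperm (strand i) (strand_succ i).

Lemma adj_transp_rel u v :
  braid_rel u v -> word_eval adj_transp u = word_eval adj_transp v.
Proof.
rewrite /word_eval; case=> [i j ij|i j ij]; rewrite !big_cons big_nil /= !mulg1.
  have ne (k l : nat) : k \in [:: i : nat; i.+1] -> l \in [:: j : nat; j.+1] ->
      k != l.
    move=> ki lj.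
    have /andP[ik ki1] : i <= k <= i.+1.
      by move: ki; rewrite !inE => /orP[]/eqP->; rewrite !leqnn !leqnSn.
    have /andP[jl lj1] : j <= l <= j.+1.
      by move: lj; rewrite !inE => /orP[]/eqP->; rewrite !leqnn !leqnSn.
    move: ij; rewrite !addn2 neq_ltn => /orP[] ij; apply/orP; [left|right].
      exact: leq_trans (leq_trans _ ij) jl.
    exact: leq_trans (leq_trans _ ij) ik.
  apply/commgP/conjg_fixP; rewrite tpermJ.
  by congr tperm; apply: tpermD; rewrite eq_sym -val_eqE /= ne ?inE ?eqxx ?orbT.
have dij : strand j = strand_succ i by apply/val_inj; rewrite /= ij.
have ne1 : strand i != strand_succ i by rewrite -val_eqE /= neq_ltn ltnSn.
have ne2 : strand_succ i != strand_succ j by rewrite -val_eqE /= ij neq_ltn ltnSn.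
have ne3 : strand i != strand_succ j by rewrite -val_eqE /= ij neq_ltn leqnSn.
rewrite /adj_transp dij; move: ne1 ne2 ne3.
move: (strand i) (strand_succ i) (strand_succ j) => a b c ab bc ac.
transitivity (tperm a c).
  rewrite -{1}[tperm a b]tpermV -[_ * _]/(tperm b c ^ tperm a b) tpermJ.
  by rewrite tpermR (tpermD ac bc).
rewrite -{1}[tperm b c]tpermV -[_ * _]/(tperm a b ^ tperm b c) tpermJ.
by rewrite tpermL tpermD // eq_sym.
Qed.

(* Permutations multiply left to right in 'S_n; the opposite convention gives a
   different map but the same kernel, inversion fixing each adj_transp i. *)
Definition braid_perm : braid_group -> 'S_n := pres_lift adj_transp.

Lemma braid_permM : {morph braid_perm : x y / x * y}.
Proof. exact: pres_liftM adj_transp_rel. Qed.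

Lemma braid_perm1 : braid_perm 1 = 1.
Proof. by apply: (mulIg (braid_perm 1)); rewrite -braid_permM !mul1g. Qed.

Lemma braid_perm_sigma i : braid_perm (sigma i) = adj_transp i.
Proof. exact: pres_lift_gen adj_transp_rel i. Qed.

HB.instance Definition _ := isUMagmaMorphism.Build braid_group 'S_n braid_perm
  (braid_perm1, braid_permM).

Definition pure_braid_group : set braid_group := [set x | braid_perm x = 1].
End Braid.

Arguments pure_braid_group : clear implicits.

(* Main.v *)
Require Import Defs.
From mathcomp Require Import all_boot all_fingroup.
From mathcomp Require Import boolp classical_sets.
From mathcomp Require Import zify.

(** Let N be the normal closure of the commutators [~ sigma i ^+ 2, sigma j ^+ 2]
with j = i + 1. As sigma i ^+ 2 is pure and the pure braids form a normal
subgroup, N lies in their commutator subgroup. Conversely, pure braids have to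
commute modulo N.

For strands a < b, let A(a, b) be the conjugate of sigma a ^+ 2 by
sigma (a+1) ... sigma (b-1): the pure braid in which the strands a and b make a
full turn around each other ([band], [pair_band]). In the braid group,
conjugating A(a, b) by a generator usually gives A(a', b'), where a', b' are the
images of a, b under the adjacent transposition; in the two exceptional positions
it gives A(a', b') conjugated by the square of the generator. The corresponding
commutator is a conjugate of one of the chosen commutators or of its inverse, so
modulo N the braid group permutes the A(a, b) through the symmetric group
([pair_bandJ]). A pure braid therefore fixes each A(a, b) modulo N, in particular
each A(i, i+1) = sigma i ^+ 2.

Thus the pure braids that commute modulo N with all pure braids form a normal
subgroup containing every sigma i ^+ 2. Such a subgroup contains every pure braid
([pure_sub_normal]), which is the content of the Coxeter presentation of the
symmetric group: adding sigma i ^+ 2 = 1 to the braid relations leaves no further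
kernel. The proof of this uses the coset representatives
sigma m sigma (m-1) ... sigma k ([desc]) of the braids on the strands 0, ..., m
among those on 0, ..., m+1, modulo the given subgroup. The representative sends
the strand m+1 to k, so a braid that fixes m+1 has the trivial one. *)

Set Implicit Arguments.
Unset Strict Implicit.
Unset Printing Implicit Defensive.

Local Open Scope classical_set_scope.
Local Open Scope group_scope.

(** * Normal subgroups and congruence modulo them *)

Section NormalSubgroups.
Variable G : groupType.
Implicit Types (A H N : set G) (x y : G).

Lemma subgroup_preim_conj H y : subgroup H -> subgroup [set x | H (x ^ y)].
Proof.
move=> /subgroupP[h1 hM hV]; apply/subgroupP; split=> /=.
- by rewrite conj1g.
- by move=> a b ha hb; rewrite conjMg; apply: hM.
- by move=> a ha; rewrite conjVg; apply: hV.
Qed.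

Lemma generated_subgroupP A : subgroup (generated_subgroup A).
Proof.
apply/subgroupP; split.
- by move=> H [/subgroupP[]].
- move=> x y hx hy H HA; have [/subgroupP[_ hM _] _] := HA.
  by apply: hM; [apply: hx|apply: hy].
- move=> x hx H HA; have [/subgroupP[_ _ hV] _] := HA.
  by apply: hV; apply: hx.
Qed.

Lemma normal_closureP A : normal_subgroup (normal_closure A).
Proof.
split; last by move=> x y hx H HA; have [[_ hJ] _] := HA; apply: hJ; apply: hx.
apply/subgroupP; split.
- by move=> H [[/subgroupP[]]].
- move=> x y hx hy H HA; have [[/subgroupP[_ hM _] _] _] := HA.
  by apply: hM; [apply: hx|apply: hy].
- move=> x hx H HA; have [[/subgroupP[_ _ hV] _] _] := HA.
  by apply: hV; apply: hx.
Qed.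

(** Conjugation maps the generating commutators to one another. *)
Lemma commutator_subgroup_normal H :
  normal_subgroup H -> normal_subgroup (commutator_subgroup H).
Proof.
move=> [_ hJ]; have gP := generated_subgroupP [set [~ x, y] | x in H & y in H].
split=> // x y hx; move: x hx; apply: smallest_sub.
  exact: subgroup_preim_conj.
move=> _ [a ha [b hb <-]] /=; rewrite conjRg.
by apply: sub_gen_smallest; exists (a ^ y); [|exists (b ^ y)]; rewrite ?hJ //;
  apply: hJ.
Qed.

Definition eq_mod N x y := N (x^-1 * y).

Section EqMod.
Variable N : set G.
Hypothesis normN : normal_subgroup N.

Lemma eq_mod_refl x : eq_mod N x x.
Proof. by case: normN => /subgroupP[h1 _ _] _; rewrite /eq_mod mulVg. Qed.

Lemma eq_mod_sym x y : eq_mod N x y -> eq_mod N y x.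
Proof.
case: normN => /subgroupP[_ _ hV] _; rewrite /eq_mod => /hV.
by rewrite invgM invgK.
Qed.

Lemma eq_mod_trans y x z : eq_mod N x y -> eq_mod N y z -> eq_mod N x z.
Proof.
case: normN => /subgroupP[_ hM _] _ xy yz; rewrite /eq_mod.
by rewrite -(mulVKg y z) mulgA; apply: hM.
Qed.

Lemma eq_modJ z x y : eq_mod N x y -> eq_mod N (x ^ z) (y ^ z).
Proof.
by case: normN => _ hJ xy; rewrite /eq_mod -conjVg -conjMg; apply: hJ.
Qed.

(** The preimage in [H] of the centre of the image of [H] modulo [N]; working with
commutators that lie in [N] replaces the quotient group. *)
Lemma centralizer_mod_normal H : normal_subgroup H ->
  normal_subgroup [set x | H x /\ forall y, H y -> N [~ x, y]].
Proof.
case: normN => /subgroupP[n1 nM nV] nJ [/subgroupP[h1 hM hV] hJ]; split.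
  apply/subgroupP; split=> /=.
  - by split=> // y _; rewrite comm1g.
  - move=> x z [hx cx] [hz cz]; split; first exact: hM.
    move=> y hy; have -> : [~ x * z, y] = [~ x, y] ^ z * [~ z, y].
      by rewrite !commgEl !conjgE !gnorm.
    by apply: nM; [apply/nJ/cx|apply: cz].
  - move=> x [hx cx]; split; first exact: hV.
    move=> y hy; have -> : [~ x^-1, y] = [~ x, y]^-1 ^ x^-1.
      by rewrite invgR !commgEl !conjgE !gnorm.
    by apply/nJ/nV/cx.
move=> x z [hx cx]; split; first exact: hJ.
move=> y hy; rewrite -(conjgKV z y) -conjRg; exact/nJ/cx/hJ.
Qed.

End EqMod.
End NormalSubgroups.

(** * Consequences of the braid relations *)

Section BraidRelations.
(** Generators are indexed by natural numbers, to keep index arithmetic out of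
ordinals: [s i] is meaningful for i < r, and commutation of distant elements is
required for all indices because [s i] will be 1 beyond that range ([nsigma]). *)
Variables (G : groupType) (r : nat) (s : nat -> G).
Hypothesis far : forall i j, i.+1 < j -> commute (s i) (s j).
Hypothesis adj : forall i, i.+1 < r ->
  s i * s i.+1 * s i = s i.+1 * s i * s i.+1.

(** The product s (k + d - 1) ... s (k + 1) s k. *)
Fixpoint desc k d : G := if d is d'.+1 then desc k.+1 d' * s k else 1.

Lemma descS k d : desc k d.+1 = desc k.+1 d * s k.
Proof. by []. Qed.

Lemma desc_far l k d : l.+1 < k -> commute (s l) (desc k d).
Proof.
elim: d k => [|d IHd] k lk /=; first exact: commute1.
by apply: commuteM; [apply: IHd; lia|apply: far].
Qed.

(** In s (k+d-1) ... s k, the letter s (k+e+1) moves left past the lower letters up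
to s (k+e+1) s (k+e); the braid relation turns it into s (k+e), which commutes
with the remaining higher letters. *)
Lemma desc_inner k d e : k + d <= r -> e.+1 < d ->
  desc k d * s (k + e.+1) = s (k + e) * desc k d.
Proof.
elim: d k e => [|d IHd] k e //= kr; rewrite ltnS => ed.
case: e ed => [|e] ed.
  rewrite addn0 addn1; case: d ed kr {IHd} => //= d _ kr.
  rewrite -!mulgA (mulgA (s k.+1)) -adj; last by lia.
  by rewrite !mulgA (desc_far d (_ : k.+1 < k.+2)).
have -> : k + e.+2 = k.+1 + e.+1 by lia.
rewrite -mulgA (far (_ : k.+1 < k.+1 + e.+1)); last by lia.
by rewrite mulgA IHd ?mulgA //; [congr (s _ * _ * _)|]; lia.
Qed.

(** The full twist of the strands i and i + d + 1. *)
Fixpoint band i d : G := if d is d'.+1 then band i d' ^ s (i + d) else s i ^+ 2.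

Lemma conjg_commute (x y : G) : commute y x -> x ^ y = x.
Proof. by move=> xy; rewrite conjgE -xy mulKg. Qed.

Lemma commute_conj (x y z : G) :
  commute x y -> commute x z -> commute x (y ^ z).
Proof.
by move=> xy xz; rewrite conjgE; do !apply: commuteM => //; apply: commuteV.
Qed.

Lemma band_right k i d : i + d.+1 < k -> commute (s k) (band i d).
Proof.
elim: d => [|d IHd] h /=.
  by apply: commuteX; apply: commute_sym; apply: far; lia.
apply: commute_conj; first by apply: IHd; lia.
by apply: commute_sym; apply: far; lia.
Qed.

Lemma band_left k i d : k.+1 < i -> commute (s k) (band i d).
Proof.
elim: d => [|d IHd] h /=; first by apply: commuteX; apply: far; lia.
by apply: commute_conj; [apply: IHd; lia|apply: far; lia].
Qed.

(** With x the twist that ends at strand k, the twist is built from x by conjugating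
with s k s (k+1) and then with higher letters. The braid relation
s k s (k+1) s k = s (k+1) s k s (k+1) turns the extra s k into s (k+1) acting on x
first, and s (k+1) commutes with x. *)
Lemma band_inner i d e : i + d < r -> e.+1 < d ->
  band i d ^ s (i + e.+1) = band i d.
Proof.
elim: d => [|d IHd] // ir; rewrite ltnS leq_eqVlt => /orP[/eqP ed|ed] /=.
  case: d ed ir {IHd} => // d [->] ir /=; rewrite -!conjgM.
  have -> : i + d.+2 = (i + d.+1).+1 by lia.
  rewrite mulgA adj; last by lia.
  rewrite -mulgA [LHS]conjgM (conjg_commute (x := band i d)) ?conjgM //.
  by apply: band_right => //; lia.
have c := far (_ : (i + e.+1).+1 < i + d.+1).
by rewrite -conjgM -c ?conjgM ?IHd //; lia.
Qed.

(** The case d = 0 is the relation s i ^ (s (i+1) s i) = s (i+1); the later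
conjugations commute with s i. *)
Lemma band_low i d : i + d.+1 < r -> band i d.+1 ^ s i = band i.+1 d.
Proof.
elim: d => [|d IHd] ir.
  rewrite /= !conjXg -conjgM addn1 conjgE [s i * _]mulgA adj; last by lia.
  by rewrite mulKg.
rewrite [LHS]/= -[band i d ^ _]/(band i d.+1) -conjgM -far; last by lia.
by rewrite conjgM IHd /=; [congr (_ ^ s _)|]; lia.
Qed.

Variable N : set G.
Hypothesis normN : normal_subgroup N.
Hypothesis commN : forall i, i.+1 < r -> N [~ s i ^+ 2, s i.+1 ^+ 2].

Lemma memJ_inv x y : N (x ^ y) -> N x.
Proof. by case: normN => _ hJ /hJ-/(_ y^-1); rewrite conjgK. Qed.

(** Conjugation by s i fixes s (i+d+1) for d > 0 and moves the low strand up by one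
([band_low]), until the two strands are adjacent. *)
Lemma comm_band_high i d : i + d.+1 < r ->
  N [~ band i d, s (i + d.+1) ^+ 2].
Proof.
elim: d i => [|d IHd] i ir; first by rewrite addn1; apply: commN; lia.
apply: (@memJ_inv _ (s i)); rewrite conjRg band_low; last by lia.
rewrite (conjg_commute (x := _ ^+ 2)); last by apply/commuteX/far; lia.
by have := IHd i.+1; rewrite addSnnS; apply.
Qed.

(** For d > 0 the commutator is the one for d - 1 conjugated by s (i+d+1); for d = 0,
conjugation by s i turns the twist into s (i+1) ^+ 2. *)
Lemma comm_band_low i d : i + d.+1 < r -> N [~ band i d.+1, s i ^+ 2].
Proof.
elim: d => [|d IHd] ir.
  apply: (@memJ_inv _ (s i)); rewrite conjRg band_low //.
  rewrite (conjg_commute (x := _ ^+ 2)); last exact/commuteX/commute_refl.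
  case: normN => /subgroupP[_ _ hV] _; rewrite -invgR; apply/hV/commN; lia.
rewrite [band _ _]/= -[band i d ^ _]/(band i d.+1).
have e : s i ^+ 2 = s i ^+ 2 ^ s (i + d.+2).
  by rewrite conjg_commute //; apply/commuteX/commute_sym/far; lia.
rewrite e -conjRg; case: normN => _; apply; apply: IHd; lia.
Qed.

(** The two sides differ by conjugation by s (i+d+1) ^+ 2. *)
Lemma band_conj_top i d : i + d.+1 < r ->
  eq_mod N (band i d.+1 ^ s (i + d.+1)) (band i d).
Proof.
move=> ir; apply: eq_mod_sym => //=.
by rewrite /eq_mod -conjgM -commgEl; apply: comm_band_high.
Qed.

(** By [band_low], the two sides differ by conjugation by s i ^+ 2. *)
Lemma band_conj_below i d : i + d.+1 < r ->
  eq_mod N (band i.+1 d ^ s i) (band i d.+1).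
Proof.
move=> ir; apply: eq_mod_sym => //.
by rewrite -band_low // /eq_mod -conjgM -commgEl; apply: comm_band_low.
Qed.

End BraidRelations.

(** * The braid group and its generators *)

Section PureBraids.
Variable n : nat.
Local Notation B := (braid_group n).
Implicit Types (i j : 'I_n.-1) (a b : 'I_n) (x y : B).

Definition word_class w : B := (\pi_(presented_group (@braid_rel n)) w)%qT.

Lemma sigmaE i : sigma i = word_class [:: (i, true)].
Proof. by []. Qed.

Lemma word_class_cat u v : word_class (u ++ v) = word_class u * word_class v.
Proof. by rewrite [RHS]pres_mulE. Qed.

Lemma word_class_inv i : word_class [:: (i, false)] = (sigma i)^-1.
Proof. by rewrite [RHS]pres_invE. Qed.

Lemma sigma_far i j : (i + 2 <= j) || (j + 2 <= i) ->
  commute (sigma i) (sigma j).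
Proof.
move=> ij; rewrite /commute !sigmaE -!word_class_cat.
by apply/eq_presP/PresRel/BraidFar.
Qed.

Lemma sigma_adj i j : j = i.+1 :> nat ->
  sigma i * sigma j * sigma i = sigma j * sigma i * sigma j.
Proof.
move=> ij; rewrite !sigmaE -!word_class_cat.
by apply/eq_presP/PresRel/BraidAdj.
Qed.

Lemma braid_ind (P : B -> Prop) : P 1 ->
  (forall x i, P x -> P (x * sigma i)) ->
  (forall x i, P x -> P (x * (sigma i)^-1)) -> forall x, P x.
Proof.
move=> P1 Pp Pm; elim/quotW => w; rewrite -/(word_class w).
elim/last_ind: w => // w [i b] IHw; rewrite -cats1 word_class_cat.
by case: b; [apply: Pp|rewrite word_class_inv; apply: Pm].
Qed.

Definition nsigma k : B := if insub k is Some i then sigma (i : 'I_n.-1) else 1.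

Lemma nsigmaE i : nsigma i = sigma i.
Proof. by rewrite /nsigma valK. Qed.

Lemma nsigma_far k l : k.+1 < l -> commute (nsigma k) (nsigma l).
Proof.
rewrite /nsigma; case: insubP => [i _ <-|_ _]; last exact/commute_sym/commute1.
case: insubP => [j _ <-|_ _]; last exact: commute1.
by move=> ij; apply: sigma_far; rewrite addn2 ij.
Qed.

Lemma nsigma_adj k : k.+1 < n.-1 ->
  nsigma k * nsigma k.+1 * nsigma k = nsigma k.+1 * nsigma k * nsigma k.+1.
Proof.
move=> kn; have := sigma_adj (i := Ordinal (ltnW kn)) (j := Ordinal kn) erefl.
by rewrite -!nsigmaE.
Qed.

Lemma pure_normal : normal_subgroup (pure_braid_group n).
Proof.
rewrite /pure_braid_group; split; last first.
  by move=> x y /= px; rewrite gmulfJ /= px conj1g.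
apply/subgroupP; split=> /=; first exact: gmulf1.
- by move=> x y px py; rewrite braid_permM px py mulg1.
- by move=> x px; rewrite gmulfV /= px invg1.
Qed.

Lemma pure_sigma2 i : pure_braid_group n (sigma i ^+ 2).
Proof.
by rewrite /pure_braid_group /= expg2 braid_permM braid_perm_sigma tperm2.
Qed.

(** * Pure braids are normally generated by squares of generators *)

Section NormalGeneration.
Variable K : set B.
Hypothesis normK : normal_subgroup K.
Hypothesis pureK : K `<=` pure_braid_group n.
Hypothesis sigma2K : forall i, K (sigma i ^+ 2).

(** The product of [K] with the monoid generated by the sigma i for i < m. As [K]
is normal and contains the squares of the generators, this is also the subgroup
generated by [K] and those sigma i. *)
Inductive below m : B -> Prop :=
| BelowK x : K x -> below m x
| BelowS x i : below m x -> i < m -> below m (x * sigma i).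

Lemma below_mulK m x y : below m x -> K y -> below m (x * y).
Proof.
case: normK => /subgroupP[_ hM _] hJ hx.
elim: hx y => {x} [x kx|x i _ IHx im] y ky.
  by apply/BelowK/hM.
by rewrite -mulgA (conjgCV (sigma i)) mulgA; apply/BelowS => //; apply/IHx/hJ.
Qed.

Lemma below_all x : below n.-1 x.
Proof.
have kJ := normK.2; have /subgroupP[k1 _ kV] := normK.1.
elim/braid_ind: x => [|x i hx|x i hx]; first exact: BelowK.
  exact: BelowS.
have -> : x * (sigma i)^-1 = x * (sigma i ^+ 2)^-1 * sigma i.
  by rewrite expg2 invgM !mulgA mulgVK.
by apply: BelowS => //; apply: below_mulK => //; apply: kV.
Qed.

(** Multiplying y * desc k d by sigma i gives four cases: i + 1 < k commutes into y;
i + 1 = k extends the product; i = k cancels its last letter up to a square, which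
[K] absorbs; i > k passes through as sigma (i - 1). *)
Lemma below_coset m x : m < n.-1 -> below m.+1 x ->
  exists k d y, [/\ k + d = m.+1, below m y & x = y * desc nsigma k d].
Proof.
have kJ := normK.2.
move=> mn; elim=> {x} [x kx|x i _ [k [d [y [kd hy ->]]]] im].
  by exists m.+1, 0, x; rewrite addn0 mulg1; split=> //; apply: BelowK.
rewrite -mulgA -nsigmaE; have [ik|ki|ik] := ltngtP i k.
- case: k kd ik => // k kd; rewrite ltnS leq_eqVlt => /orP[/eqP ->|ik].
    by exists k, d.+1, y; split=> //; lia.
  exists k.+1, d, (y * sigma i); split=> //; first by apply: BelowS => //; lia.
  by rewrite -(desc_far nsigma_far) // nsigmaE mulgA.
- have e : i = k + (i - k.+1).+1 :> nat by lia.
  rewrite e (desc_inner nsigma_far nsigma_adj); [|lia..].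
  have h : k + (i - k.+1) < n.-1 by lia.
  exists k, d, (y * sigma (Ordinal h)); split=> //.
    by apply: BelowS => //=; lia.
  by rewrite -nsigmaE mulgA.
- case: d kd => [|d] kd; first by lia.
  exists k.+1, d, (y * sigma i ^+ 2 ^ (desc nsigma k.+1 d)^-1).
  split; first lia.
    by apply: below_mulK => //; apply: kJ.
  rewrite descS -ik nsigmaE -[_ * _ * sigma i]mulgA -expg2.
  by rewrite (conjgCV (desc _ _ _)) mulgA.
Qed.

Lemma below_fix m x a : below m x -> m < a -> braid_perm x a = a.
Proof.
move=> hx ma; elim: hx => {x} [x /pureK /= ->|x i _ IHx im].
  by rewrite perm1.
rewrite braid_permM permM IHx braid_perm_sigma.
by rewrite tpermD // -val_eqE /=; lia.
Qed.

Lemma desc_perm k d a b : a = k + d :> nat -> b = k :> nat ->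
  braid_perm (desc nsigma k d) a = b.
Proof.
elim: d k b => [|d IHd] k b ak bk /=.
  by rewrite braid_perm1 perm1; apply: val_inj; rewrite /= ak bk addn0.
have kn : k < n.-1 by have := ltn_ord a; lia.
rewrite braid_permM permM (IHd _ (strand_succ (Ordinal kn))) //; last by lia.
have := nsigmaE (Ordinal kn) => /= ->.
by rewrite braid_perm_sigma tpermR; apply: val_inj; rewrite /= bk.
Qed.

(** Induction on m: since x fixes the strand m+1, which the representative in
[below_coset] sends to k, the representative is 1 and x is already below m. *)
Lemma below_pure m x : m <= n.-1 -> below m x -> pure_braid_group n x -> K x.
Proof.
elim: m x => [|m IHm] x mn.
  by case.
move=> hx px; have [k [d [y [kd hy ex]]]] := below_coset mn hx.
case: d => [|d] in kd ex *.
  by apply: IHm => //; [exact: ltnW|rewrite ex mulg1].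
have an : m.+1 < n by lia.
have bn : k < n by lia.
have e1 := below_fix (a := Ordinal an) hy (ltnSn m).
have e2 := @desc_perm k d.+1 (Ordinal an) (Ordinal bn) (esym kd) erefl.
have : braid_perm (y * desc nsigma k d.+1) (Ordinal an) = Ordinal an.
  by rewrite -ex px perm1.
rewrite braid_permM permM e1 e2 => /(congr1 val) /=; lia.
Qed.

Lemma pure_sub_normal : pure_braid_group n `<=` K.
Proof. by move=> x; apply: below_pure (below_all x). Qed.

End NormalGeneration.

(** * The action on full twists modulo the commutators *)

(** [band] for an unordered pair of distinct strands; its second argument is the
number of strands in between. *)
Definition pair_band a b : B :=
  band nsigma (minn a b) (maxn a b - minn a b).-1.

Lemma pair_bandC a b : pair_band a b = pair_band b a.
Proof. by rewrite /pair_band minnC maxnC. Qed.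

Lemma pair_bandE k d a b : a = k :> nat -> b = (k + d).+1 :> nat ->
  pair_band a b = band nsigma k d.
Proof.
by move=> ai bi; rewrite /pair_band; congr band; lia.
Qed.

Section ActionModN.
Variable N : set B.
Hypothesis normN : normal_subgroup N.
Hypothesis commN : forall i j, j = i.+1 :> nat ->
  N [~ sigma i ^+ 2, sigma j ^+ 2].

Lemma nsigma_commN k : k.+1 < n.-1 -> N [~ nsigma k ^+ 2, nsigma k.+1 ^+ 2].
Proof.
move=> kn; have := commN (i := Ordinal (ltnW kn)) (j := Ordinal kn) erefl.
by rewrite -!nsigmaE.
Qed.

(** The cases follow the position of i relative to a < b. Only i = a - 1 and
i = b - 1 > a need the congruence; in the other cases the equality holds in the
braid group. *)
Lemma pair_bandJ_sigma i a b : a != b ->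
  eq_mod N (pair_band a b ^ sigma i)
           (pair_band (adj_transp i a) (adj_transp i b)).
Proof.
wlog ab : a b / a < b.
  move=> H ne; have := ne; rewrite -val_eqE neq_ltn => /orP[ab|ba].
    exact: H.
  rewrite pair_bandC (pair_bandC (adj_transp i a)).
  by apply: H; rewrite // eq_sym.
move=> _; have bn := ltn_ord b.
have [d bE] : exists d, b = (a + d).+1 :> nat by exists (b - a.+1); lia.
rewrite (pair_bandE erefl bE) -nsigmaE /adj_transp.
have fixE (c : 'I_n) : c != i :> nat -> c != i.+1 :> nat ->
    tperm (strand i) (strand_succ i) c = c.
  by move=> c1 c2; rewrite tpermD // -val_eqE eq_sym.
have eqN (x y : B) : x = y -> eq_mod N x y by move=> ->; apply: eq_mod_refl.
have toL (c : 'I_n) : c = i.+1 :> nat ->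
    tperm (strand i) (strand_succ i) c = strand i.
  by move=> ci; rewrite (_ : c = strand_succ i) ?tpermR //; apply: val_inj.
have toR (c : 'I_n) : c = i :> nat ->
    tperm (strand i) (strand_succ i) c = strand_succ i.
  by move=> ci; rewrite (_ : c = strand i) ?tpermL //; apply: val_inj.
have F := nsigma_far; have A := nsigma_adj; have C := nsigma_commN.
have [ia|ai|ai] := ltngtP i a.
- have [ia1|ia1] := eqVneq (a : nat) i.+1.
    rewrite toL // fixE; [|lia..].
    rewrite (@pair_bandE i d.+1) /=; [|lia..].
    by rewrite ia1; apply: (band_conj_below F A) => //; lia.
  rewrite !fixE; [|lia..].
  rewrite (pair_bandE erefl bE) conjg_commute; first exact: eq_mod_refl.
  by apply: band_left => //; lia.
- have [ib|bi|ib] := ltngtP i b.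
  + have [ib1|ib1] := eqVneq (b : nat) i.+1.
      rewrite fixE; [|lia..]; rewrite toL //.
      case: d bE => [|d] bE; first by lia.
      rewrite (@pair_bandE a d) /=; [|lia..].
      have -> : i = a + d.+1 :> nat by lia.
      by apply: (band_conj_top F A) => //; lia.
    rewrite !fixE; [|lia..].
    rewrite (pair_bandE erefl bE); apply: eqN.
    have -> : i = a + (i - a.+1).+1 :> nat by lia.
    by apply: (band_inner F A); lia.
  + rewrite !fixE; [|lia..].
    rewrite (pair_bandE erefl bE) conjg_commute; first exact: eq_mod_refl.
    by apply: band_right => //; lia.
  + rewrite fixE; [|lia..]; rewrite toR //.
    rewrite (@pair_bandE a d.+1) /=; [|lia..].
    by apply: eqN; rewrite ib bE addnS.
- rewrite toR //; have [bi|bi] := eqVneq (b : nat) i.+1.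
    rewrite toL // pair_bandC (@pair_bandE i d) /=; [|lia..].
    have -> : d = 0 by lia.
    rewrite -ai /= conjg_commute; first exact: eq_mod_refl.
    exact/commuteX/commute_refl.
  rewrite fixE; [|lia..].
  case: d bE => [|d] bE; first by lia.
  rewrite (@pair_bandE i.+1 d) /=; [|lia..].
  by rewrite ai; apply: eqN; apply: (band_low F A); lia.
Qed.

(** Both the braid action on twists and the permutation action on strands are right
actions, so the formula extends from generators to products; for an inverse
generator, conjugate back. *)
Lemma pair_bandJ x a b : a != b ->
  eq_mod N (pair_band a b ^ x) (pair_band (braid_perm x a) (braid_perm x b)).
Proof.
elim/braid_ind: x a b => [|x i IHx|x i IHx] a b ab.
- by rewrite conjg1 braid_perm1 !perm1; apply: eq_mod_refl.
- rewrite conjgM braid_permM !permM braid_perm_sigma.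
  apply: (eq_mod_trans normN (eq_modJ normN _ (IHx _ _ ab))).
  by apply: pair_bandJ_sigma; rewrite (inj_eq perm_inj).
- rewrite conjgM braid_permM gmulfV /= !permM braid_perm_sigma.
  rewrite [(adj_transp i)^-1]tpermV.
  apply: (eq_mod_trans normN (eq_modJ normN _ (IHx _ _ ab))).
  rewrite -[X in eq_mod N _ X](conjgK (sigma i)); apply: (eq_modJ normN).
  set c := braid_perm x a; set d := braid_perm x b.
  apply: (eq_mod_sym normN).
  have := @pair_bandJ_sigma i (adj_transp i c) (adj_transp i d).
  by rewrite !tpermK; apply; rewrite !(inj_eq perm_inj).
Qed.

(** sigma i ^+ 2 is the twist of two adjacent strands, and x fixes both strands. *)
Lemma pure_comm_sigma2 i x : pure_braid_group n x -> N [~ sigma i ^+ 2, x].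
Proof.
move=> px; have ne : strand i != strand_succ i by rewrite -val_eqE /=; lia.
have := eq_mod_sym normN (pair_bandJ x ne).
rewrite px !perm1 (@pair_bandE i 0) /= ?addn0 // nsigmaE.
by rewrite /eq_mod -commgEl.
Qed.

(** The subgroup of [centralizer_mod_normal] contains the squares of the generators
by [pure_comm_sigma2], hence all pure braids. *)
Lemma pure_comm x y :
  pure_braid_group n x -> pure_braid_group n y -> N [~ x, y].
Proof.
move=> px py.
have nC := centralizer_mod_normal normN pure_normal.
have sub := pure_sub_normal nC.
have [z []|i|_ h] // := sub _ _ x px; last exact: h.
by split; [exact: pure_sigma2|move=> z; exact: pure_comm_sigma2].
Qed.

End ActionModN.
End PureBraids.

(** * The commutator subgroup of the pure braid group *)

Theorem mainTheorem2 (n : nat) (hn : (3 <= n)%N) :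
  commutator_subgroup (pure_braid_group n) =
  normal_closure [set x : braid_group n | exists i j : 'I_n.-1,
    j = i.+1 :> nat /\ x = [~ sigma i ^+ 2, sigma j ^+ 2]].
Proof.
apply/seteqP; split.
  have normN := normal_closureP [set x : braid_group n | exists i j : 'I_n.-1,
    j = i.+1 :> nat /\ x = [~ sigma i ^+ 2, sigma j ^+ 2]].
  apply: smallest_sub; first exact: normN.1.
  move=> _ [x px [y py <-]]; apply: (pure_comm normN _ px py) => i j ij.
  by apply: sub_gen_smallest; exists i, j.
apply: smallest_sub; first exact/commutator_subgroup_normal/pure_normal.
move=> _ [i [j [_ ->]]]; apply: sub_gen_smallest.
exists (sigma i ^+ 2); first exact: pure_sigma2.
by exists (sigma j ^+ 2); first exact: pure_sigma2.
Qed.
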